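(* Let $G$ be a graph with $p\ge 3$ vertices, and let $n\to\infty$. (i) If $G$ has no isolated vertices, i.e., $\delta(G)\ge 1$, then $g(n,K_p|\langle G\rangle)=O(n)$. (ii) If $G$ has isolated vertices, but $\Delta(G)\ge p/2$, then $g(n,K_p|\langle G\rangle)=O(n^{2-\epsilon})$ for some $\epsilon=\epsilon(G)>0$.
   Context: $\delta(G)$ and $\Delta(G)$ are the minimum and maximum degree of $G$. For a graph $F$, $\langle F\rangle$ is the family of all graphs containing $F$ as a subgraph (not necessarily induced); when $F$ has isolated vertices, a color class inside a copy of $K_p$ is regarded as a spanning subgraph of that copy. In an edge coloring of $K_n$ (not necessarily proper), for a copy $G'\subseteq K_n$ of a graph $G$, a color class of $G'$ is the graph formed by all edges of $G'$ having a given color that occurs in $G'$. For a family $\mathcal{F}$ of graphs with $K_2\notin\mathcal{F}$ and $n\ge|G|$, $g(n,G|\mathcal{F})$ is the largest integer $m$ for which there exists an edge coloring of $K_n$ using exactly $m$ colors such that every copy of $G$ contains a color class which is a member of $\mathcal{F}$; if no such coloring exists, then $g(n,G|\mathcal{F}):=0$. *)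

(* Defs.v *)
From mathcomp Require Import all_boot.

Set Implicit Arguments.
Unset Strict Implicit.
Unset Printing Implicit Defensive.

Record sgraph := SGraph {
  vertex :> finType;
  adj : rel vertex;
  adj_sym : symmetric adj;
  adj_irrefl : irreflexive adj }.

Definition degree (G : sgraph) (u : G) : nat := #|[set v | adj u v]|.

(* Degrees are smaller than #|G|, so the neutral value #|G| is never reached
   on a nonempty graph. *)
Definition min_degree (G : sgraph) : nat := \big[minn/#|G|]_(u : G) degree u.

Definition max_degree (G : sgraph) : nat := \max_(u : G) degree u.

Definition complete_adj (p : nat) : rel 'I_p := fun u v => u != v.

Lemma complete_adj_sym p : symmetric (@complete_adj p).
Proof. by move=> u v; rewrite /complete_adj eq_sym. Qed.

Lemma complete_adj_irrefl p : irreflexive (@complete_adj p).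
Proof. by move=> u; rewrite /complete_adj eqxx. Qed.

Definition complete_graph (p : nat) : sgraph :=
  SGraph (@complete_adj_sym p) (@complete_adj_irrefl p).

(* The family <F>: H belongs to it when F is a (not necessarily induced)
   subgraph of H. *)
Definition containing (F : sgraph) : pred sgraph := fun H =>
  [exists f : {ffun F -> H},
    injectiveb f && [forall u, forall v, adj u v ==> adj (f u) (f v)]].

(* An edge coloring of K_n with colors in 'I_m; an edge is a 2-element set of
   vertices, and the values on other sets are irrelevant. *)
Definition coloring (n m : nat) := {ffun {set 'I_n} -> 'I_m}.

Definition uses_all_colors (n m : nat) (c : coloring n m) : bool :=
  [forall a : 'I_m, exists e : {set 'I_n}, (#|e| == 2) && (c e == a)].

Section ColorClass.
Variables (n m : nat) (c : coloring n m).
Variables (H : sgraph) (f : {ffun H -> 'I_n}) (a : 'I_m).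

Definition class_adj : rel H := fun u v => adj u v && (c [set f u; f v] == a).

Lemma class_adj_sym : symmetric class_adj.
Proof. by move=> u v; rewrite /class_adj adj_sym setUC. Qed.

Lemma class_adj_irrefl : irreflexive class_adj.
Proof. by move=> u; rewrite /class_adj adj_irrefl. Qed.

(* For f injective, the class of color a in the copy of H embedded by f,
   transported to the vertices of H. It is a spanning subgraph of the copy:
   vertices incident to no edge of color a are kept as isolated vertices, which
   does not affect containment of a graph without isolated vertices. *)
Definition color_class : sgraph := SGraph class_adj_sym class_adj_irrefl.

Definition color_occurs : bool := [exists u, exists v, class_adj u v].

End ColorClass.

Definition good_coloring (n : nat) (H : sgraph) (F : pred sgraph) (m : nat)
    (c : coloring n m) : bool :=
  [forall f : {ffun H -> 'I_n}, injectiveb f ==>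
    [exists a : 'I_m, color_occurs c f a && F (color_class c f a)]].

Definition attainable (n : nat) (H : sgraph) (F : pred sgraph) (m : nat) : bool :=
  [exists c : coloring n m, uses_all_colors c && good_coloring H F c].

(* g(n, H | F), for isomorphism-closed F. The bound on m only makes the maximum
   finite (see attainable_le); a maximum over no m is 0. *)
Definition gnum (n : nat) (H : sgraph) (F : pred sgraph) : nat :=
  \max_(m < 'C(n, 2).+1 | attainable n H F m) m.

Lemma attainable_le n H F m : attainable n H F m -> m <= 'C(n, 2).
Proof.
case/existsP=> c /andP[/forallP surj _].
have -> : 'C(n, 2) = #|[set e : {set 'I_n} | #|e| == 2]|.
  by rewrite card_draws card_ord.
rewrite -[leqLHS]card_ord -cardsT.
apply: leq_trans (leq_imset_card c _).
apply/subset_leq_card/subsetP => a _.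
have /existsP[e /andP[e2 /eqP <-]] := surj a.
by apply: imset_f; rewrite inE.
Qed.

(* Main.v *)
Require Import Defs.
From HB Require Import structures.
From mathcomp Require Import all_boot zify.

Set Implicit Arguments.
Unset Strict Implicit.
Unset Printing Implicit Defensive.

(** In an edge coloring of K_n in which every K_p has a color class containing
    G, the number of colors is bounded by exhibiting a set of p vertices inside
    which no single color can carry a copy of G.

    When G has no isolated vertex, a color carrying G inside p vertices meets
    all of them. Consider a vertex v, a set W not containing v, and the colors
    found between v and W but not within W: inside W + v each of them forms a
    star at v. If p - 1 such colors existed, v together with one neighbor for
    each would be p vertices; the color meeting v would be one of these star
    colors, and would miss a third vertex. So adding a vertex to W creates at most p - 2 colors
    ([few_colors_new_at]), and adding the vertices one at a time gives at most
    (p - 2) n colors ([linear_bound]).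

    When G has a vertex of degree at least p/2, choose one edge of each color.
    If there are many colors, this rainbow graph is dense enough to contain a
    large complete bipartite graph ([biclique_of_edges], a weak form of the
    Kovari-Sos-Turan theorem). Each color lies on only one chosen edge, so the
    sides can be pruned so that no color inside a side occurs between the
    sides ([avoid_inner_colors], used twice). Keep about p/2 vertices on each
    side: a monochromatic star then either lies inside one side, or is a single
    edge between the sides ([mono_star_le]), so its degree is below p/2
    ([large_degree_bound]). *)

(** * Finite sets and copies of G in a given vertex set *)

Lemma subset_of_card (T : finType) (A : {set T}) k :
  k <= #|A| -> exists2 B : {set T}, B \subset A & #|B| = k.
Proof.
case/card_geqP=> s [us <- sA]; exists [set x in s].
  by apply/subsetP=> x; rewrite inE => /sA.
by rewrite cardsE; apply/card_uniqP.
Qed.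

Lemma min_degree_le (G : sgraph) (u : G) : min_degree G <= degree u.
Proof.
rewrite /min_degree; have := mem_index_enum u.
elim: (index_enum G) => //= v s IH; rewrite inE big_cons => /predU1P[<- | /IH].
  exact: geq_minl.
exact: leq_trans (geq_minr _ _).
Qed.

(** Since the complete graph has all edges, goodness depends only on the vertex
    set of a copy; this form avoids choosing embeddings of K_p. *)
Lemma mono_copy n m p (G : sgraph) (c : coloring n m) (S : {set 'I_n}) :
  good_coloring (complete_graph p) (containing G) c -> #|S| = p ->
  exists a, exists h : G -> 'I_n,
    [/\ injective h, forall u, h u \in S &
        forall u v, adj u v -> c [set h u; h v] = a].
Proof.
move=> good Sp.
pose f : {ffun complete_graph p -> 'I_n} :=
  [ffun i => enum_val (cast_ord (esym Sp) i)].
have f_inj : injective f.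
  by move=> i j; rewrite !ffunE => /enum_val_inj/cast_ord_inj.
have /forallP/(_ f)/implyP/(_ _)/existsP[|] := good.
  exact/injectiveP.
move=> a /andP[_ /existsP[g /andP[/injectiveP g_inj /forallP hom]]].
exists a, (fun u => f (g u)); split=> [u v /f_inj/g_inj // | u | u v uv].
  by rewrite ffunE enum_valP.
have /forallP/(_ v)/implyP/(_ uv) /= := hom u.
by case/andP=> _ /eqP.
Qed.

(** The value 0 has to be treated separately: it is also the value taken when
    no coloring exists. *)
Lemma gnum_ind n (H : sgraph) (F : pred sgraph) (P : nat -> Prop) :
  P 0 ->
  (forall m (c : coloring n m),
     uses_all_colors c -> good_coloring H F c -> P m) ->
  P (gnum n H F).
Proof.
move=> P0 Pm; apply: big_ind => // [x y Px Py | m].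
  by rewrite /maxn; case: ifP.
by case/existsP=> c /andP[]; apply: Pm.
Qed.

(** * Graphs without isolated vertices *)

Definition colors_within n m (c : coloring n m) (W : {set 'I_n}) : {set 'I_m} :=
  [set c [set x; y] | x in W, y in W & x != y].

(** Given p - 1 new colors at [v], take [v] and one neighbor [g a] for each new
    color [a]. A copy of G in one color covers all p vertices; its color at [v]
    is some new [a], which on these vertices occurs only on the edge from [v]
    to [g a], so that [g b] is missed for any other new color [b]. *)
Lemma few_colors_new_at n m p (G : sgraph) (c : coloring n m) (W : {set 'I_n}) v :
  3 <= p -> #|G| = p -> 1 <= min_degree G ->
  good_coloring (complete_graph p) (containing G) c -> v \notin W ->
  #|[set c [set v; w] | w in W] :\: colors_within c W| <= p.-2.
Proof.
move=> p3 Gp Gdeg good vW; rewrite leqNgt; apply/negP=> many.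
have [N /subsetP sN Ncard] := subset_of_card many.
have {}Ncard : #|N| = p.-1 by rewrite Ncard; case: (p) p3 => [|[]].
pose g a := odflt v [pick w in W | c [set v; w] == a].
have gP a : a \in N -> [/\ g a \in W, c [set v; g a] = a
                         & a \notin colors_within c W].
  move=> /sN; rewrite in_setD /g => /andP[-> /imsetP[w wW ->]].
  case: pickP => [x /andP[xW /eqP] // | /(_ w)] /=.
  by rewrite wW eqxx.
have g_inj : {in N &, injective g}.
  by move=> a b /gP[_ ca _] /gP[_ cb _] gab; rewrite -ca -cb gab.
have vg : v \notin g @: N.
  by apply: contra vW => /imsetP[a /gP[gaW _ _] ->].
have Sp : #|v |: g @: N| = p.
  by rewrite cardsU1 vg card_in_imset // Ncard; case: (p) p3.
have [a [h [h_inj hS hc]]] := mono_copy good Sp.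
(* Here |G| = p forces the copy of G to be spanning. *)
have h_onto x : x \in v |: g @: N -> exists u, x = h u.
  have -> : v |: g @: N = h @: [set: G].
    apply/esym/eqP; rewrite eqEcard Sp card_imset // cardsT Gp leqnn andbT.
    by apply/subsetP=> _ /imsetP[u _ ->].
  by case/imsetP=> u _ ->; exists u.
have nbr u : exists2 w, adj u w & h w != h u.
  have /card_gt0P[w] : 0 < degree u by apply: leq_trans (min_degree_le u).
  rewrite inE => uw; exists w => //; apply/eqP=> /h_inj wu.
  by move: uw; rewrite wu adj_irrefl.
have aN : a \in N.
  have [u0 vE] := h_onto v (setU11 _ _).
  have [w uw] := nbr u0; have := hS w; have := hc _ _ uw.
  rewrite -vE !inE => <- /orP[/eqP-> | /imsetP[b bN ->] _]; first by rewrite eqxx.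
  by have [_ -> _] := gP b bN.
(* p >= 3 provides a second new color. *)
have [b] : exists b, b \in N :\ a.
  apply/set0Pn; rewrite -card_gt0; have := cardsD1 a N.
  by rewrite aN Ncard; lia.
rewrite in_setD1 => /andP[ba bN]; have [gbW gbc _] := gP b bN.
have [|u gbE] := h_onto (g b); first by rewrite in_setU1 imset_f ?orbT.
have [w uw hwu] := nbr u; have := hS w; have := hc _ _ uw.
rewrite -gbE in hwu * => ca; rewrite in_setU1 => /predU1P[hwv | ].
  by case/eqP: ba; rewrite -gbc -ca hwv setUC.
case/imsetP=> d /gP[gdW _ _] hwd; have [_ _ /negP[]] := gP a aN.
by rewrite -ca hwd; apply: imset2_f => //; rewrite inE gdW -hwd eq_sym.
Qed.

Lemma linear_bound n m p (G : sgraph) (c : coloring n m) :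
  3 <= p -> #|G| = p -> 1 <= min_degree G ->
  uses_all_colors c -> good_coloring (complete_graph p) (containing G) c ->
  m <= p.-2 * n.
Proof.
move=> p3 Gp Gdeg /forallP surj good.
have within k (W : {set 'I_n}) : #|W| <= k -> #|colors_within c W| <= p.-2 * k.
  elim: k W => [|k IH] W Wk.
    rewrite leqn0 cards_eq0 in Wk; rewrite (eqP Wk) muln0 leqn0 cards_eq0.
    by apply/eqP/setP=> a; rewrite inE; apply/negP=> /imset2P[x y]; rewrite in_set0.
  have [W0 | [v vW]] := set_0Vmem W.
    by apply: leq_trans (IH W _) _; rewrite ?W0 ?cards0 // leq_mul2l leqnSn orbT.
  have [W'k vW'] : #|W :\ v| <= k /\ v \notin W :\ v.
    by rewrite -ltnS (leq_trans _ Wk) ?(cardsD1 v W) ?vW // !inE eqxx.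
  pose new := [set c [set v; w] | w in W :\ v] :\: colors_within c (W :\ v).
  apply: (@leq_trans #|new :|: colors_within c (W :\ v)|).
    apply/subset_leq_card/subsetP=> _ /imset2P[x y xW + ->]; rewrite inE.
    case/andP=> yW xy; rewrite in_setU in_setD.
    case: (boolP (_ \in _)) => //= out; rewrite orbF.
    have [xv | xv] := eqVneq x v.
      by apply/imsetP; exists y; rewrite ?xv // in_setD1 yW -xv eq_sym xy.
    have [yv | yv] := eqVneq y v.
      by apply/imsetP; exists x; rewrite ?yv 1?setUC // in_setD1 xv.
    case/negP: out; apply: imset2_f; first by rewrite in_setD1 xv.
    by rewrite inE in_setD1 yv yW.
  apply: leq_trans (leq_card_setU _ _) _.
  by rewrite mulnS leq_add ?IH ?(few_colors_new_at p3 Gp).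
rewrite -[m in m <= _]card_ord; apply: leq_trans (within n [set: _] _); last first.
  by rewrite cardsT card_ord.
apply/subset_leq_card/subsetP=> a _; have /existsP[e] := surj a.
case/andP=> /cards2P[x [y [xy ->]]] /eqP<-.
by apply: imset2_f; rewrite !inE.
Qed.

(** * Complete bipartite subgraphs of dense graphs *)

Lemma leq_exp_base e a b : a <= b -> a ^ e <= b ^ e.
Proof. by case: e => // e ab; rewrite leq_exp2r. Qed.

Lemma ffact_ge_exp D t : (D - t) ^ t <= D ^_ t.
Proof.
elim: t => // t IH; rewrite ffactnSr expnS mulnC leq_mul ?leq_sub2l //.
by apply: leq_trans IH; rewrite leq_exp_base // leq_sub2l.
Qed.

Lemma ffact_le_exp D t : D ^_ t <= D ^ t.
Proof.
by elim: t => // t IH; rewrite ffactnSr expnS mulnC leq_mul // leq_subr.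
Qed.

(** The vertices of degree below [D] account for at most half of the degree sum,
    and each remaining vertex for at most #|V|. *)
Lemma many_high_degree (V : finType) (e : rel V) D :
  0 < #|V| -> 2 * #|V| * D <= \sum_u #|[set v | e u v]| ->
  D <= #|[set u | D <= #|[set v | e u v]|]|.
Proof.
set H := [set u | _] => V0 dense.
have : \sum_u #|[set v | e u v]| <= \sum_u (D + (u \in H) * #|V|).
  apply: leq_sum => u _; rewrite inE; have [_ | /ltnW Du] := leqP D _.
    by rewrite mul1n -[leqLHS]add0n leq_add ?max_card.
  by rewrite mul0n addn0.
move/(leq_trans dense).
rewrite big_split /= -big_distrl /= sum_nat_const -big_mkcond /= sum1_card.
by rewrite -mulnA mul2n -addnn leq_add2l mulnC leq_pmul2r.
Qed.

(** Count pairs of a vertex of degree at least [D] and a [t]-subset of its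
    neighborhood. Restricting to high-degree vertices replaces the usual
    convexity argument; it weakens the exponent from 2 - 1/t to 2 - 1/(t+1). *)
Lemma biclique_of_edges (V : finType) (e : rel V) D t s :
  0 < #|V| -> 2 * #|V| * D <= \sum_u #|[set v | e u v]| ->
  s * #|V| ^ t < (D - t) ^ t.+1 ->
  exists A B : {set V}, [/\ #|A| = t, s <= #|B| &
    forall b a, b \in B -> a \in A -> e b a].
Proof.
move=> V0 dense big.
pose H := [set u | D <= #|[set v | e u v]|].
pose common (A : {set V}) := [set u in H | A \subset [set v | e u v]].
have [/existsP[A /andP[/eqP At As]] | /existsPn none] :=
    boolP [exists A : {set V}, (#|A| == t) && (s <= #|common A|)].
  exists A, (common A); split=> // b a; rewrite inE => /andP[_ /subsetP sub].
  by move=> /sub; rewrite inE.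
move: big; rewrite ltnNge => /negP[].
apply: (@leq_trans (\sum_(u in H) #|[set v | e u v]| ^_ t)).
  apply: (@leq_trans (\sum_(u in H) (D - t) ^ t)).
    rewrite sum_nat_const expnS leq_mul //.
    by apply: leq_trans (leq_subr _ _) _; apply: many_high_degree.
  apply: leq_sum => u; rewrite inE => Du; apply: leq_trans (ffact_ge_exp _ _).
  by rewrite leq_exp_base // leq_sub2r.
under eq_bigr => u _ do rewrite -bin_ffact -cards_draws -sum1dep_card.
rewrite -big_distrl /= (exchange_big_dep (fun A : {set V} => #|A| == t)) /=; last first.
  by move=> u A _ /andP[].
apply: (@leq_trans ((\sum_(A : {set V} | #|A| == t) s) * t`!)).
  rewrite leq_mul2r; apply/orP; right; apply: leq_sum => A At.
  have := none A; rewrite negb_and -ltnNge => /orP[/negP[] // | /ltnW].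
  apply: leq_trans.
  rewrite sum1dep_card subset_leq_card //; apply/subsetP=> u.
  by rewrite !inE => /and3P[-> ->].
rewrite sum_nat_const -cardsE card_draws mulnAC bin_ffact mulnC.
by rewrite leq_mul2l ffact_le_exp orbT.
Qed.

(** * Graphs with a vertex of degree at least p/2 *)

Lemma representatives n m (c : coloring n m) : uses_all_colors c ->
  exists r : 'I_m -> {set 'I_n}, forall a, #|r a| = 2 /\ c (r a) = a.
Proof.
move/forallP=> surj.
suff /fin_all_exists[r rP] : forall a, exists e : {set 'I_n}, #|e| = 2 /\ c e = a.
  by exists r.
move=> a; by have /existsP[e /andP[/eqP e2 /eqP ce]] := surj a; exists e.
Qed.

Definition rep_adj n m (c : coloring n m) (r : 'I_m -> {set 'I_n}) : rel 'I_n :=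
  fun u v => (u != v) && (r (c [set u; v]) == [set u; v]).

Lemma rep_degree_sum n m (c : coloring n m) (r : 'I_m -> {set 'I_n}) :
  (forall a, #|r a| = 2 /\ c (r a) = a) ->
  m <= \sum_u #|[set v | rep_adj c r u v]|.
Proof.
move=> rP; under eq_bigr => u _ do rewrite -sum1dep_card.
rewrite pair_big_dep /= sum1dep_card -[m in m <= _]card_ord -cardsT.
apply: leq_trans (leq_imset_card (fun x : 'I_n * 'I_n => c [set x.1; x.2]) _).
apply/subset_leq_card/subsetP=> a _; have [ra ca] := rP a.
have /eqP/cards2P[x [y [xy rE]]] := ra.
by apply/imsetP; exists (x, y); rewrite ?inE /= /rep_adj -rE ca ?xy ?eqxx.
Qed.

Lemma card_bigcup_le (I T : finType) (P : pred I) (F : I -> {set T}) :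
  #|\bigcup_(i | P i) F i| <= \sum_(i | P i) #|F i|.
Proof.
elim/big_rec2: _ => [|i x B _ IH]; first by rewrite cards0.
by apply: leq_trans (leq_card_setU _ _) _; rewrite leq_add2l.
Qed.

(** A color inside [A] spoils only the two ends of its representative edge, so
    deleting at most 2 |A|^2 vertices of [B] separates these colors from the
    representative edges meeting what remains of [B]. *)
Lemma avoid_inner_colors n m (c : coloring n m) (r : 'I_m -> {set 'I_n})
    (A B : {set 'I_n}) k :
  (forall a, #|r a| = 2) -> k + 2 * #|A| ^ 2 <= #|B| ->
  exists B' : {set 'I_n}, [/\ B' \subset B, #|B'| = k &
    forall x y b, x \in A -> y \in A -> b \in B' -> b \notin r (c [set x; y])].
Proof.
move=> r2 kB.
pose U := \bigcup_(z in setX A A) r (c [set z.1; z.2]).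
have kBU : k <= #|B :\: U|.
  rewrite cardsD leq_subRL ?subset_leq_card ?subsetIl // addnC.
  apply: leq_trans kB; rewrite leq_add2l.
  apply: leq_trans (subset_leq_card (subsetIr _ _)) _.
  apply: leq_trans (card_bigcup_le _ _) _.
  under eq_bigr => z _ do rewrite r2.
  by rewrite sum_nat_const cardsX mulnC.
have [B' sB' B'k] := subset_of_card kBU; exists B'; split=> //.
  exact: subset_trans sB' (subsetDl _ _).
move=> x y b xA yA /(subsetP sB'); rewrite inE => /andP[+ _]; apply: contra => br.
by apply/bigcupP; exists (x, y); rewrite // in_setX xA.
Qed.

(** The star at [w] in one color either has an edge to [B], and then rainbowness
    and the absence of this color between [w] and [A] leave room for no other
    edge, or stays inside [A]. *)
Lemma mono_star_le n m (c : coloring n m) (A B N : {set 'I_n}) w a :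
  w \in A -> w \notin N -> N \subset A :|: B ->
  (forall x, x \in N -> c [set w; x] = a) ->
  (forall x b, x \in A -> b \in B -> c [set w; x] <> c [set w; b]) ->
  {in B &, injective (fun b => c [set w; b])} ->
  #|N| <= maxn 1 #|A|.-1.
Proof.
move=> wA wN /subsetP sN ca inner rainbow.
have [NB0 | [b /setIP[bN bB]]] := set_0Vmem (N :&: B); last first.
  suff: N \subset [set b].
    by move/subset_leq_card; rewrite cards1 leq_max => ->.
  apply/subsetP=> x xN; rewrite inE; apply/eqP.
  have /setUP[xA | xB] := sN x xN; last by apply: rainbow => //; rewrite !ca.
  by case: (inner x b) => //; rewrite !ca.
suff: N \subset A :\ w.
  by move/subset_leq_card; rewrite (cardsD1 w A) wA leq_max => ->; rewrite orbT.
apply/subsetP=> x xN; rewrite in_setD1.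
have -> : x != w by apply: contraNneq wN => <-.
have /setUP[// | xB] := sN x xN.
by have := in_set0 x; rewrite -NB0 inE xN xB.
Qed.

(** The quantity [m %/ (2 * n)] is a lower bound for half the average degree of
    the representative graph. The side sizes leave room for both prunings:
    first the side of size [s] loses the vertices spoiled by colors inside the
    side of size [t], down to [uphalf p]; then the side of size [t] loses those
    spoiled by colors inside the pruned side, down to [p./2]. *)
Lemma large_degree_bound n m p (G : sgraph) (c : coloring n m) :
  let t := p./2 + 2 * (uphalf p) ^ 2 in
  let s := uphalf p + 2 * t ^ 2 in
  3 <= p -> #|G| = p -> p <= 2 * max_degree G -> 0 < n ->
  uses_all_colors c -> good_coloring (complete_graph p) (containing G) c ->
  (m %/ (2 * n) - t) ^ t.+1 <= s * n ^ t.
Proof.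
move=> t s p3 Gp Gdeg n0 surj good; rewrite leqNgt; apply/negP=> big.
have [r rP] := representatives surj.
have r2 a : #|r a| = 2 by have [] := rP a.
have [|||A0 [B0 [A0t B0s cross]]] :=
    @biclique_of_edges _ (rep_adj c r) (m %/ (2 * n)) t s.
- by rewrite card_ord.
- by rewrite card_ord mulnC; apply: leq_trans (leq_divM _ _) (rep_degree_sum rP).
- by rewrite card_ord.
have [|B [/subsetP sB Bk innerA]] := @avoid_inner_colors _ _ c r A0 B0 (uphalf p) r2.
  by rewrite A0t.
have [|A [/subsetP sA Ak innerB]] := @avoid_inner_colors _ _ c r B A0 p./2 r2.
  by rewrite A0t Bk.
have rE a b : a \in A -> b \in B -> r (c [set a; b]) = [set a; b].
  by move=> /sA aA /sB bB; have /andP[_ /eqP] := cross _ _ bB aA; rewrite setUC.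
have AB : [disjoint A & B].
  apply/pred0P=> x /=; apply/andP=> -[/sA xA /sB xB].
  by have := cross x x xB xA; rewrite /rep_adj eqxx.
have Sp : #|A :|: B| = p.
  by rewrite cardsU disjoint_setI0 // cards0 subn0 Ak Bk; lia.
have [a [h [h_inj hS hc]]] := mono_copy good Sp.
have [|u uD] := eq_bigmax (@degree G); first by rewrite Gp; lia.
pose N := h @: [set v | adj u v].
have Ncard : #|N| = max_degree G by rewrite card_imset.
have huN : h u \notin N.
  by apply/imsetP=> -[v]; rewrite inE => uv /h_inj uE; move: uv; rewrite -uE adj_irrefl.
have Nc x : x \in N -> c [set h u; x] = a.
  by case/imsetP=> v; rewrite inE => uv ->; apply: hc.
have NS : N \subset A :|: B by apply/subsetP=> _ /imsetP[v _ ->].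
have : #|N| <= maxn 1 (uphalf p).-1; last by rewrite Ncard; lia.
have := hS u; rewrite inE => /orP[huA | huB].
  apply: leq_trans (mono_star_le huA huN NS Nc _ _) _.
  - move=> x b xA bB cE; have /negP[] := innerA _ _ _ (sA _ huA) (sA _ xA) bB.
    by rewrite cE rE // !inE eqxx orbT.
  - move=> b b' bB b'B cE; have : b \in [set h u; b'].
      by rewrite -rE // -cE rE // !inE eqxx orbT.
    by rewrite !inE => /predU1P[bu | /eqP //]; have := disjointFr AB huA; rewrite -bu bB.
  by rewrite Ak; lia.
rewrite -Bk; rewrite setUC in NS; apply: (mono_star_le huB huN NS Nc).
- move=> x b xB bA cE; have /negP[] := innerB _ _ _ huB xB bA.
  by rewrite cE setUC rE // !inE eqxx.
- move=> b b' bA b'A cE; have : b \in [set b'; h u].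
    rewrite -rE // setUC -cE setUC rE //.
    by rewrite !inE eqxx.
  by rewrite !inE => /orP[/eqP // | /eqP bu]; have := disjointFr AB bA; rewrite bu huB.
Qed.

From mathcomp Require Import all_order all_algebra.
From mathcomp Require Import all_classical all_reals all_analysis.
From mathcomp Require Import lra ring.

Import Order.TTheory GRing.Theory Num.Theory.
Import numFieldNormedType.Exports.
Local Open Scope classical_set_scope.
Local Open Scope ring_scope.

(** * Asymptotic bounds *)

Lemma bigO_of_nat_bound (R : realType) (f : nat -> nat) (g : nat -> R) (K : R) :
  0 < K -> (forall n, (0 < n)%N -> 0 <= g n) ->
  (forall n, (0 < n)%N -> (f n)%:R <= K * g n) ->
  (fun n => (f n)%:R : R) =O_\oo g.
Proof.
move=> K0 g0 fg; apply/eqO_exP; exists K => //.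
exists 1%N => // n /= n0.
by rewrite normr_nat ger0_norm ?g0 // fg.
Qed.

(** Taking (t+1)-st roots bounds the quotient by a multiple of n^(1 - 1/(t+1))
    plus t; multiplying back by 2n gives the exponent 2 - 1/(t+1). *)
Lemma powR_bound_of_exp_bound (R : realType) (n m t s : nat) :
  (0 < n)%N -> ((m %/ (2 * n) - t) ^ t.+1 <= s * n ^ t)%N ->
  (m%:R : R) <= (2 * (t + s + 2))%:R * n%:R `^ (2 - t.+1%:R^-1).
Proof.
move=> n0 bound.
set e : R := t.+1%:R^-1.
have n1 : 1 <= n%:R :> R by rewrite ler1n.
have e1 : e <= 1 by rewrite invf_le1 ?ltr0n // ler1n.
set q : R := n%:R `^ (1 - e).
have q1 : 1 <= q by rewrite -(powRr0 n%:R) ler_powR // subr_ge0.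
have qX : q ^+ t.+1 = n%:R ^+ t.
  rewrite -powR_mulrn ?powR_ge0 // -powRrM mulrBl mul1r mulVf ?pnatr_eq0 //.
  by rewrite -natr1 addrK powR_mulrn.
have Dq : (m %/ (2 * n) - t)%:R <= (s.+1)%:R * q.
  rewrite -(@ler_pXn2r _ t.+1) ?nnegrE ?ler0n ?mulr_ge0 ?powR_ge0 //.
  rewrite exprMn qX.
  apply: (@le_trans _ _ (s * n ^ t)%:R); first by rewrite -natrX ler_nat.
  rewrite natrM natrX ler_wpM2r ?exprn_ge0 // -natrX ler_nat.
  by apply: leq_trans (leqnSn s) _; rewrite -{1}(expn1 s.+1) leq_pexp2l.
have -> : n%:R `^ (2 - e) = n%:R * q.
  rewrite -{2}(powRr1 (ltW (lt_le_trans ltr01 n1))) -powRD; first by congr powR; lra.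
  by rewrite pnatr_eq0 -lt0n n0 implybT.
have mD : (m <= (m %/ (2 * n) - t + t + 1) * (2 * n))%N.
  have := ltn_ceil m (_ : (0 < 2 * n)%N); rewrite muln_gt0 n0 => /(_ isT) /ltnW.
  move/leq_trans; apply; rewrite leq_mul2r; apply/orP; right.
  by rewrite addn1 ltnS; lia.
apply: (@le_trans _ _ ((s.+1%:R * q + t%:R * q + q) * (2 * n%:R))).
  apply: le_trans (_ : ((m %/ (2 * n) - t + t + 1) * (2 * n))%:R <= _).
    by rewrite ler_nat.
  rewrite 2!natrM ler_wpM2r ?mulr_ge0 ?ler0n // 2!natrD.
  by rewrite !lerD // ler_peMr.
rewrite natrM 2!natrD -natr1 le_eqVlt; apply/orP; left; apply/eqP; ring.
Qed.

Theorem theorem9p20 (R : realType) (p : nat) (G : sgraph)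
    (hp : (3 <= p)%N) (hG : #|G| = p) :
  ((1 <= min_degree G)%N ->
     (fun n : nat => (gnum n (complete_graph p) (containing G))%:R : R)
       =O_\oo (fun n : nat => n%:R : R))
  /\
  ((exists v : G, degree v = 0%N) -> p%:R / 2 <= (max_degree G)%:R :> R ->
     exists2 eps : R, 0 < eps &
       (fun n : nat => (gnum n (complete_graph p) (containing G))%:R : R)
         =O_\oo (fun n : nat => n%:R `^ (2 - eps) : R)).
Proof.
split=> [Gdeg | _ Gdeg].
  apply: (@bigO_of_nat_bound _ _ _ p%:R) => [|n n0|n n0].
  - by rewrite ltr0n; apply: leq_trans hp.
  - exact: ler0n.
  rewrite -natrM ler_nat; elim/gnum_ind: (gnum _ _ _) => // m c surj good.
  apply: leq_trans (linear_bound hp hG Gdeg surj good) _.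
  by rewrite leq_mul2r; lia.
have {}Gdeg : (p <= 2 * max_degree G)%N.
  by rewrite -(ler_nat R) natrM; lra.
pose t := (p./2 + 2 * (uphalf p) ^ 2)%N; pose s := (uphalf p + 2 * t ^ 2)%N.
exists t.+1%:R^-1; first by rewrite invr_gt0 ltr0n.
apply: (@bigO_of_nat_bound _ _ _ (2 * (t + s + 2))%:R) => [|n n0|n n0].
- by rewrite ltr0n muln_gt0 addn2.
- exact: powR_ge0.
elim/gnum_ind: (gnum _ _ _) => [|m c surj good].
  by rewrite mulr_ge0 ?powR_ge0.
exact: powR_bound_of_exp_bound n0 (large_degree_bound hp hG Gdeg n0 surj good).
Qed.
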